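(* Let $p$ be a prime, $q=p^e$, and $q_0=p^m$ with integers $1\le m\le e$. Then $$|\mathcal B_{W_{q_0+1}^{\mathrm{Luc}}}|=\begin{cases}\dfrac{\binom{q+1}{3}}{\binom{q_0+1}{3}}=\dfrac{q(q^2-1)}{q_0(q_0^2-1)},&\text{if }m\mid e,\\[8pt]0,&\text{if }m\nmid e.\end{cases}$$ Moreover, if $m\mid e$, then $(\mathbb P^1(\mathbb F_q),\mathcal B_{W_{q_0+1}^{\mathrm{Luc}}})$ is a Steiner system $S(3,q_0+1,q+1)$, that is, a $3$-$(q+1,q_0+1,1)$ design.
   Context: For nonnegative integers $i,k$ with base-$p$ expansions $i=\sum_r i_rp^r$, $k=\sum_r k_rp^r$ ($0\le i_r,k_r\le p-1$), write $i\le_p k$ if $i_r\le k_r$ for all $r$. $\mathbb F_q[X,Y]_k$ is the space of homogeneous polynomials of degree $k$ over $\mathbb F_q$. The Lucas subspace is $W_k^{\mathrm{Luc}}=\mathrm{span}_{\mathbb F_q}\{X^{k-i}Y^i:0\le i\le k,\ i\le_p k\}\subseteq\mathbb F_q[X,Y]_k$. $\mathbb P^1(\mathbb F_q)=\mathbb F_q\cup\{\infty\}$. For a $k$-subset $S\subseteq\mathbb P^1(\mathbb F_q)$, $F_S(X,Y)=\prod_{t\in S}(X-tY)$, where the factor for $t=\infty$ is taken to be $Y$. For a subspace $W\subseteq\mathbb F_q[X,Y]_k$, $\mathcal B_W=\{S\subseteq\mathbb P^1(\mathbb F_q): |S|=k,\ F_S\in W\}$. A $t$-$(v,k,\lambda)$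 design is a pair $(P,\mathcal B)$ with $P$ a finite set, $|P|=v$, and $\mathcal B$ a set of $k$-subsets of $P$ such that every $t$-subset of $P$ is contained in exactly $\lambda$ members of $\mathcal B$. *)

(* Defs.v *)
From HB Require Import structures.
From mathcomp Require Import all_boot all_order all_algebra.
From mathcomp Require Export mpoly.

Set Implicit Arguments.
Unset Strict Implicit.
Unset Printing Implicit Defensive.

Import GRing.Theory.
Local Open Scope ring_scope.

Definition digit (p n r : nat) : nat := ((n %/ p ^ r) %% p)%N.

(* All base-p digits of i at positions r >= i vanish when p > 1, so testing the
   positions r < i suffices; see [lepP]. *)
Definition lep (p i k : nat) : bool :=
  [forall r : 'I_i, (digit p i r <= digit p k r)%N].

Lemma lepP (p i k : nat) : (1 < p)%N ->
  reflect (forall r, (digit p i r <= digit p k r)%N) (lep p i k).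
Proof.
move=> p1; apply: (iffP forallP) => [H r|H r]; last exact: H.
have [ri|ir] := ltnP r i; first exact: (H (Ordinal ri)).
have ip : (i < p ^ r)%N by apply: leq_ltn_trans ir _; exact: ltn_expl.
by rewrite {1}/digit divn_small // mod0n.
Qed.

Section Forms.
Variable F : finFieldType.

Definition vX : {mpoly F[2]} := 'X_ord0.
Definition vY : {mpoly F[2]} := 'X_ord_max.

(* F[X,Y]_k, the homogeneous polynomials of degree k together with 0. *)
Definition forms (k : nat) := dhomog 2 F k.

Lemma vX_homog : vX \is 1.-homog.
Proof. by rewrite dhomogX /= mdeg1. Qed.

Lemma vY_homog : vY \is 1.-homog.
Proof. by rewrite dhomogX /= mdeg1. Qed.

Lemma monomial_homog (k : nat) (i : 'I_k.+1) :
  vX ^+ (k - i) * vY ^+ i \is k.-homog.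
Proof.
rewrite -[X in X.-homog](subnK (leq_ord i)).
have HX := dhomogMn (k - i) vX_homog; have HY := dhomogMn i vY_homog.
by rewrite !mul1n in HX HY; exact: dhomogM.
Qed.

Definition monomial (k : nat) (i : 'I_k.+1) : forms k :=
  DHomog (monomial_homog i).

Definition WLuc (p k : nat) : {vspace forms k} :=
  <<[seq monomial i | i : 'I_k.+1 <- enum 'I_k.+1 & lep p i k]>>%VS.

(* The projective line over F; [None] is the point at infinity. *)
Definition P1 : finType := option F.

Definition point_form (t : P1) : {mpoly F[2]} :=
  if t is Some a then vX - a *: vY else vY.

Definition set_form (S : {set P1}) : {mpoly F[2]} :=
  \prod_(t in S) point_form t.

Lemma point_form_homog (t : P1) : point_form t \is 1.-homog.
Proof.
case: t => [a|]; last exact: vY_homog.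
by apply: rpredB; [exact: vX_homog | apply: rpredZ; exact: vY_homog].
Qed.

Lemma set_form_homog (S : {set P1}) : set_form S \is #|S|.-homog.
Proof.
rewrite /set_form -sum1_card.
elim/big_ind2: _ => [|d f e g Hf Hg|t _]; first exact: dhomog1.
  exact: dhomogM.
exact: point_form_homog.
Qed.

(* [indhomog k f] is f itself, seen in [forms k], when f is homogeneous of
   degree k, which holds for [set_form S] when #|S| = k; see [blocksP]. *)
Definition blocks (k : nat) (W : {vspace forms k}) : {set {set P1}} :=
  [set S : {set P1} | (#|S| == k) && (indhomog k (set_form S) \in W)].

Lemma blocksP (k : nat) (W : {vspace forms k}) (S : {set P1}) :
  reflect (#|S| = k /\ exists2 w : forms k, w \in W & val w = set_form S)
          (S \in blocks W).
Proof.
rewrite inE; apply: (iffP andP) => [[/eqP Sk SW]|[Sk [w wW wS]]].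
  split=> //; exists (indhomog k (set_form S)) => //.
  by rewrite /indhomog insubdK // -Sk; exact: set_form_homog.
by split; [exact/eqP | rewrite -wS /indhomog valKd].
Qed.

End Forms.

Definition is_design (P : finType) (B : {set {set P}})
    (t v k lambda : nat) : Prop :=
  [/\ #|P| = v,
      forall S : {set P}, S \in B -> #|S| = k
    & forall T : {set P}, #|T| = t ->
        #|[set S in B | T \subset S]| = lambda].

Definition is_steiner (P : finType) (B : {set {set P}}) (t k v : nat) : Prop :=
  is_design B t v k 1.

(* Main.v *)
(* By Lucas digits, W_{q0+1} is spanned by X^(q0+1), X^q0 Y, X Y^q0, Y^(q0+1), so
   its elements are the forms z |-> Phi(z^q0, z) with Phi bilinear.  As x |-> x^q0
   is additive, a change of basis turns such a form into one of the same kind, so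
   three of its zeros may be moved to oo, 0, 1; the form is then a multiple of
   X^q0 Y - X Y^q0.  Hence a nonzero form vanishing at t1, t2, t3 has its zeros
   exactly where the cross-ratio with t1, t2, t3 is oo or fixed by x |-> x^q0.  There
   are q0 + 1 such points when m divides e, and fewer otherwise.  The number of
   blocks follows by counting pairs (3-subset, block containing it). *)
Require Import Defs.
From mathcomp Require Import all_boot all_order all_algebra.
From mathcomp Require Import finfield ring zify.
Set Implicit Arguments.
Unset Strict Implicit.
Unset Printing Implicit Defensive.
Import GRing.Theory.
Local Open Scope ring_scope.

(** * Base-[p] digits of [p ^ m + 1] *)

Lemma dvdn_digits0 (p n i : nat) : (0 < p)%N ->
  (forall r, (r < n)%N -> digit p i r = 0%N) -> (p ^ n %| i)%N.
Proof.
move=> p0; elim: n => [|n IHn] H; first by rewrite expn0 dvd1n.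
have pn := IHn (fun r rn => H r (ltnW rn)).
rewrite expnSr -(divnK pn) [in X in (_ %| X)%N]mulnC dvdn_pmul2l ?expn_gt0 ?p0 //.
by rewrite /dvdn; apply/eqP; exact: H.
Qed.

(** As [m > 0], the digits of [p ^ m + 1] are 1 at the distinct positions 0 and [m], and 0
    elsewhere; this leaves two independent choices of a digit 0 or 1. *)
Lemma lep_qS (p m i : nat) : prime p -> (0 < m)%N -> (i <= p ^ m + 1)%N ->
  lep p i (p ^ m + 1) = (i \in [:: 0; 1; p ^ m; p ^ m + 1]%N).
Proof.
move=> /prime_gt1 p1 m0 ik; have p0 := ltnW p1.
have pm0 r : (0 < p ^ r)%N by rewrite expn_gt0 p0.
have pm1 : (1 < p ^ m)%N by rewrite -{1}(expn0 p) ltn_exp2l.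
have dq r : digit p (p ^ m) r = (r == m).
  rewrite /digit; case: (ltngtP r m) => [rm|mr|->].
  - rewrite -(subnK (ltnW rm)) expnD mulnK // -(subnSK rm) expnS.
    by rewrite modnMr.
  - by rewrite divn_small ?mod0n // ltn_exp2l.
  - by rewrite divnn pm0 modn_small.
have d1 r : digit p 1 r = (r == 0%N).
  rewrite /digit; case: r => [|r]; first by rewrite expn0 divn1 modn_small.
  by rewrite divn_small ?mod0n // -{1}(expn0 p) ltn_exp2l.
have dk r : digit p (p ^ m + 1) r = ((r == 0) || (r == m))%N.
  rewrite /digit; have [->|r0] := eqVneq r 0%N.
    by rewrite expn0 divn1 -(prednK m0) expnS mulnC modnMDl modn_small.
  case: (leqP r m) => [rm|mr].
    rewrite divnDl ?dvdn_exp2l // [(1 %/ _)%N]divn_small ?addn0; last first.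
      by rewrite -{1}(expn0 p) ltn_exp2l // lt0n.
    by have := dq r; rewrite /digit => ->.
  rewrite gtn_eqF //= divn_small ?mod0n //.
  apply: leq_trans (_ : p ^ m.+1 <= _)%N; last by rewrite leq_exp2l.
  by rewrite expnS; nia.
apply/lepP/idP => // [H|].
  have i0 : (i %% p <= 1)%N.
    by have := H 0%N; rewrite dk /digit expn0 divn1.
  (* The digits of [i] strictly between positions 0 and [m] vanish, so [i = c * p ^ m + i %% p], and
     the bound on [i] forces [c <= 1]. *)
  have : (p ^ m.-1 %| i %/ p)%N.
    apply: dvdn_digits0 => // r rm; apply/eqP; rewrite -leqn0.
    have := H r.+1; rewrite dk /= /digit -divnMA -expnS.
    have -> // : (r.+1 == m) = false by apply/negbTE; lia.
  case/dvdnP=> c cE; have iE : (i = c * p ^ m + i %% p)%N.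
    by rewrite {1}(divn_eq i p) cE -mulnA -expnSr prednK.
  have c1 : (c <= 1)%N by nia.
  rewrite iE !inE; move: c1 i0; case: c {iE cE} => [|[|//]] _;
    case: (i %% p)%N => [|[|//]] _; rewrite ?mul0n ?mul1n ?addn0 ?add0n eqxx ?orbT //.
rewrite !inE => /or4P[] /eqP-> r //; rewrite ?dk ?dq ?d1.
- by rewrite /digit div0n mod0n.
- by case: (r == 0%N).
- by case: (r == m); rewrite ?orbT.
Qed.

(** * Fixed points of the power map in a finite field *)

Lemma dvdp_expXn_subX (R : idomainType) (n d : nat) :
  ('X^n - 'X : {poly R}) %| 'X^(n ^ d) - 'X.
Proof.
elim: d => [|d IHd]; first by rewrite expn0 expr1 subrr dvdp0.
(* The first bracket is a difference of [n]-th powers, hence a multiple of ['X^(n ^ d) - 'X], to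
   which the induction hypothesis applies. *)
have -> : 'X^(n ^ d.+1) - 'X = ('X^(n ^ d) ^+ n - 'X^n) + ('X^n - 'X) :> {poly R}.
  by rewrite -exprM -expnSr addrA subrK.
rewrite dvdp_addl ?dvdpp // subrXX.
exact: dvdp_mulr.
Qed.

Section FixedPoints.
Variable F : finFieldType.

Definition fixed (n : nat) : {set F} := [set x | x ^+ n == x].

Lemma size_XnsubX (n : nat) : (1 < n)%N -> size ('X^n - 'X : {poly F}) = n.+1.
Proof. by move=> n1; rewrite size_polyDl size_polyXn ?size_polyN ?size_polyX. Qed.

Lemma card_fixed_le (n : nat) : (1 < n)%N -> (#|fixed n| <= n)%N.
Proof.
move=> n1; rewrite cardE -ltnS -(size_XnsubX n1); apply: max_poly_roots.
- by rewrite -size_poly_gt0 size_XnsubX.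
- apply/allP => x; rewrite mem_enum inE => /eqP xn.
  by rewrite rootE !hornerE xn subrr.
- exact: enum_uniq.
Qed.

(** ['X^n - 'X] divides ['X^#|F| - 'X], the product of all ['X - x%:P], so it is associate to a
    product of distinct linear factors; its degree counts them. *)
Lemma card_fixed_root (n d : nat) :
  (1 < n)%N -> #|F| = (n ^ d)%N -> #|fixed n| = n.
Proof.
move=> n1 cF; apply/eqP; rewrite eqn_leq card_fixed_le //=.
have := dvdp_expXn_subX F n d; rewrite -cF finField_genPoly.
rewrite -big_enum => /dvdp_prod_XsubC[b Xb].
have := eqp_size Xb; rewrite size_XnsubX // size_prod_XsubC => -[nE].
rewrite {1}nE cardE; apply: uniq_leq_size.
  by rewrite mask_uniq // enum_uniq.
move=> x xb; rewrite mem_enum inE -subr_eq0.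
have : root ('X^n - 'X) x by rewrite (eqp_root Xb) root_prod_XsubC.
by rewrite rootE !hornerE.
Qed.

(** Let [r = e %% m], so [0 < r < m]. Iterating [x ^+ (p ^ m) = x] and using [x ^+ #|F| = x] gives
    [x ^+ (p ^ r) = x], which has at most [p ^ r] solutions. *)
Lemma card_fixed_nroot (p e m : nat) :
  (1 < p)%N -> (0 < m)%N -> #|F| = (p ^ e)%N -> ~~ (m %| e)%N ->
  (#|fixed (p ^ m)| < p ^ m)%N.
Proof.
move=> p1 m0 cF; rewrite /dvdn -lt0n => r0.
have rm := ltn_pmod e m0.
apply: leq_trans (_ : p ^ (e %% m) < _)%N; last by rewrite ltn_exp2l.
rewrite ltnS; apply: leq_trans (card_fixed_le _); last first.
  by rewrite -{1}(expn0 p) ltn_exp2l.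
apply: subset_leq_card; apply/subsetP => x; rewrite !inE => /eqP xm.
have xmd d : x ^+ (p ^ (d * m)) = x.
  by elim: d => [|d IHd]; rewrite ?expr1 // mulSn expnD exprM xm.
by rewrite -{2}(expf_card x) cF {2}(divn_eq e m) expnD exprM xmd.
Qed.
End FixedPoints.

(** * Cross-ratio and sublines of the projective line *)

Section ProjectiveLine.
Variable F : finFieldType.
Implicit Types (s t u v : P1 F) (w z : F * F).

(** The representative is chosen so that [point_form t] vanishes at [vec t]. *)
Definition vec t : F * F := if t is Some x then (x, 1) else (1, 0).

Definition det2 w z : F := w.1 * z.2 - w.2 * z.1.

Lemma det2_vec_eq0 s t : (det2 (vec s) (vec t) == 0) = (s == t).
Proof.
case: s t => [x|] [y|]; rewrite /det2 /= ?mulr1 ?mul1r ?mulr0 ?mul0r.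
- by rewrite subr_eq0.
- by rewrite sub0r oppr_eq0 oner_eq0.
- by rewrite subr0 oner_eq0.
- by rewrite subrr !eqxx.
Qed.

Section CrossRatio.
Variables t1 t2 t3 : P1 F.
Hypotheses (t12 : t1 != t2) (t13 : t1 != t3) (t23 : t2 != t3).

Let D s t := det2 (vec s) (vec t).
Let Dn0 s t : s != t -> D s t != 0.
Proof. by rewrite -det2_vec_eq0. Qed.

(* The cross-ratio with [t1], [t2], [t3] sent to oo, 0, 1. *)
Let b_neq0 t : D t1 t != 0 -> D t1 t * D t3 t2 != 0.
Proof. by move=> t1n; rewrite mulf_neq0 // Dn0 // eq_sym. Qed.

Definition cross_ratio t : P1 F :=
  if D t1 t == 0 then None else Some (D t t2 * D t1 t3 / (D t1 t * D t3 t2)).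

Lemma cross_ratio_inj : injective cross_ratio.
Proof.
move=> s t; rewrite /cross_ratio; case: ifPn => s1; case: ifPn => t1' //.
  by move: s1 t1'; rewrite /D !det2_vec_eq0 => /eqP<- /eqP<-.
case=> /eqP; rewrite eqr_div ?b_neq0 // => /eqP E.
apply/eqP; rewrite -det2_vec_eq0.
(* A Plücker relation: the difference of the cross-multiplied values factors through the determinant
   of [s] and [t]. *)
have : det2 (vec s) (vec t) * (D t1 t2 * D t1 t3 * D t3 t2) = 0.
  transitivity (D s t2 * D t1 t3 * (D t1 t * D t3 t2) - D t t2 * D t1 t3 * (D t1 s * D t3 t2)).
    by rewrite /D /det2; ring.
  by rewrite E subrr.
have d0 : D t1 t2 * D t1 t3 * D t3 t2 != 0.
  by rewrite !mulf_neq0 // Dn0 // eq_sym.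
by move/eqP; rewrite mulf_eq0 (negbTE d0) orbF.
Qed.

(** When [fixed F n] is a subfield, this is the subline over it through [t1], [t2], [t3]. *)
Definition subline (n : nat) : {set P1 F} :=
  cross_ratio @^-1: (None |: [set Some x | x in fixed F n]).

Lemma card_subline (n : nat) : #|subline n| = #|fixed F n|.+1.
Proof.
rewrite card_preimset; last exact: cross_ratio_inj.
rewrite cardsU1 card_imset; last exact: Some_inj.
by have -> : None \notin [set Some x | x in fixed F n] by apply/imsetP; case.
Qed.

(** Clearing denominators also covers the value oo, where both sides are 0 because [n > 0].
    Numerator and denominator are linear in [vec t], so this is the equation of a form Phi(z^n,
    z). *)
Lemma in_subline (n : nat) t : (0 < n)%N ->
  (t \in subline n) =
  ((D t t2 * D t1 t3) ^+ n * (D t1 t * D t3 t2)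
     == (D t1 t * D t3 t2) ^+ n * (D t t2 * D t1 t3)).
Proof.
move=> n0; rewrite !inE /cross_ratio.
have [->|t1n] := eqVneq (D t1 t) 0.
  by rewrite !mul0r mulr0 expr0n gtn_eqF // mul0r !eqxx.
have b0 := b_neq0 t1n.
rewrite /= mem_imset; last exact: Some_inj.
by rewrite inE expr_div_n eqr_div ?expf_neq0 // [X in _ == X]mulrC.
Qed.

Lemma sub_subline (n : nat) : (0 < n)%N -> [set t1; t2; t3] \subset subline n.
Proof.
move=> n0; have Dxx s : D s s = 0 by rewrite /D /det2 mulrC subrr.
apply/subsetP => t; rewrite in_subline // !inE -orbA => /or3P[] /eqP->.
- by rewrite Dxx !(mul0r, mulr0) expr0n gtn_eqF // mul0r.
- by rewrite Dxx !(mul0r, mulr0) expr0n gtn_eqF // mul0r.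
- by rewrite [D t3 t2 * _]mulrC.
Qed.

End CrossRatio.

(** * Forms Phi(z^n, z) with Phi bilinear, and their zeros *)

Section LucasForm.
Variables (n : nat).
Hypothesis (n_gt0 : (0 < n)%N).
Hypothesis exprDn : forall x y : F, (x + y) ^+ n = x ^+ n + y ^+ n.

Let exprBn (x y : F) : (x - y) ^+ n = x ^+ n - y ^+ n.
Proof. by apply/(addIr (y ^+ n)); rewrite -exprDn !subrK. Qed.

(** At [w = frob z] this is a X^(n+1) + b X^n Y + c X Y^n + d Y^(n+1). Keeping [w] and [z]
    independent gives bilinearity, hence a change of basis. *)
Definition bil (a b c d : F) w z : F :=
  w.1 * (a * z.1 + b * z.2) + w.2 * (c * z.1 + d * z.2).

Definition frob z : F * F := (z.1 ^+ n, z.2 ^+ n).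

Lemma frob_det2 w z : det2 (frob w) (frob z) = det2 w z ^+ n.
Proof. by rewrite /det2 exprBn !exprMn. Qed.

Definition vanishes a b c d t := bil a b c d (frob (vec t)) (vec t) == 0.

(* Cramer's rule for [w] in the basis [x1, x2] and for [z] in [z1, z2]. *)
Lemma bil_cramer a b c d (x1 x2 z1 z2 w z : F * F) :
  det2 x1 x2 * det2 z1 z2 * bil a b c d w z =
    det2 w x2 * det2 z z2 * bil a b c d x1 z1
  + det2 w x2 * det2 z1 z * bil a b c d x1 z2
  + det2 x1 w * det2 z z2 * bil a b c d x2 z1
  + det2 x1 w * det2 z1 z * bil a b c d x2 z2.
Proof. by rewrite /det2 /bil; ring. Qed.

(** In the basis [t1], [t2] the diagonal entries of the form vanish, leaving [P] and [Q]. The zero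
    [t3] fixes their ratio, and the equation at [t] becomes that of the subline. *)
Lemma vanishes_subline a b c d t1 t2 t3 t :
  t1 != t2 -> t1 != t3 -> t2 != t3 -> (a, b, c, d) != 0 ->
  vanishes a b c d t1 -> vanishes a b c d t2 -> vanishes a b c d t3 ->
  vanishes a b c d t -> t \in subline t1 t2 t3 n.
Proof.
move=> t12 t13 t23 abcd /eqP v1 /eqP v2 /eqP v3 /eqP v.
rewrite in_subline //; set B := bil a b c d.
set D := fun s t => det2 (vec s) (vec t).
have Dn0 s u : s != u -> D s u != 0 by rewrite -det2_vec_eq0.
set P := B (frob (vec t1)) (vec t2); set Q := B (frob (vec t2)) (vec t1).
have key w z : D t1 t2 ^+ n * D t1 t2 * B w z =
     det2 w (frob (vec t2)) * det2 (vec t1) z * P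
   + det2 (frob (vec t1)) w * det2 z (vec t2) * Q.
  rewrite /D -{1}frob_det2 (bil_cramer a b c d _ _ (vec t1) (vec t2)) v1 v2.
  by rewrite !mulr0 add0r addr0.
have kv u : B (frob (vec u)) (vec u) = 0 ->
    D u t2 ^+ n * D t1 u * P + D t1 u ^+ n * D u t2 * Q = 0.
  by move=> vu; rewrite /D -!frob_det2 -key vu mulr0.
have k3 := kv _ v3; have kt := kv _ v.
(* If [P = 0], the equation at [t3] gives [Q = 0]; then [key] makes [B] identically zero, and its
   values on the standard basis are the coefficients. *)
have P0 : P != 0.
  apply: contra_neq abcd => P0; have Q0 : Q = 0.
    apply/eqP; move/eqP: k3; rewrite P0 mulr0 add0r mulf_eq0.
    by rewrite (negbTE (mulf_neq0 (expf_neq0 _ (Dn0 _ _ t13)) (Dn0 _ _ _))) // eq_sym.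
  have B0 w z : B w z = 0.
    apply/eqP; have /eqP := key w z; rewrite P0 Q0 !mulr0 addr0 mulf_eq0.
    by rewrite mulf_eq0 expf_eq0 n_gt0 (negbTE (Dn0 _ _ t12)).
  have := (B0 (1, 0) (1, 0), B0 (1, 0) (0, 1), (B0 (0, 1) (1, 0), B0 (0, 1) (0, 1))).
  rewrite /B /bil /= !(mulr0, mulr1, mul0r, mul1r, addr0, add0r).
  by case=> -[-> ->] [-> ->].
have Z : (D t t2 * D t1 t3) ^+ n * (D t1 t * D t3 t2)
       - (D t1 t * D t3 t2) ^+ n * (D t t2 * D t1 t3) = 0.
  apply: (mulfI P0); rewrite mulr0 !exprMn.
  have D13 := expf_neq0 n (Dn0 _ _ t13).
  apply: (mulIf (Dn0 _ _ t13)); rewrite mul0r.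
  (* The combination of the equations at [t] and [t3] in which [Q] cancels; the extra factor
     [D t1 t3] is nonzero. *)
  transitivity (D t1 t3 ^+ n * D t1 t3 * D t3 t2 *
     (D t t2 ^+ n * D t1 t * P + D t1 t ^+ n * D t t2 * Q)
    - D t1 t ^+ n * D t t2 * D t1 t3 *
     (D t3 t2 ^+ n * D t1 t3 * P + D t1 t3 ^+ n * D t3 t2 * Q)); first by ring.
  by rewrite kt k3 !mulr0 subrr.
by rewrite -subr_eq0 -/D -/(D t t2) -/(D t1 t3) -/(D t1 t) -/(D t3 t2) Z.
Qed.

(** The form is the equation of [in_subline], expanded by additivity of the [n]-th power. *)
Lemma subline_vanishes t1 t2 t3 :
  t1 != t2 -> t1 != t3 -> t2 != t3 ->
  exists f : F * F * F * F, f != 0 /\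
    (forall t, t \in subline t1 t2 t3 n ->
       vanishes f.1.1.1 f.1.1.2 f.1.2 f.2 t).
Proof.
move=> t12 t13 t23.
set D := fun s t => det2 (vec s) (vec t).
(* Coefficients, in the coordinates of [vec t], of the numerator ([A1], [A2]) and denominator ([B1],
   [B2]) of the cross-ratio. *)
pose A1 := (vec t2).2 * D t1 t3; pose A2 := - (vec t2).1 * D t1 t3.
pose B1 := - (vec t1).2 * D t3 t2; pose B2 := (vec t1).1 * D t3 t2.
exists (A1 ^+ n * B1 - B1 ^+ n * A1, A1 ^+ n * B2 - B1 ^+ n * A2,
        A2 ^+ n * B1 - B2 ^+ n * A1, A2 ^+ n * B2 - B2 ^+ n * A2); split; last first.
  move=> t; rewrite in_subline // -/D -/(D t t2) -/(D t1 t3) -/(D t1 t) -/(D t3 t2).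
  have -> : D t t2 * D t1 t3 = (vec t).1 * A1 + (vec t).2 * A2.
    by rewrite /A1 /A2 /D /det2; ring.
  have -> : D t1 t * D t3 t2 = (vec t).1 * B1 + (vec t).2 * B2.
    by rewrite /B1 /B2 /D /det2; ring.
  rewrite !exprDn !exprMn /vanishes /bil /frob /= -subr_eq0.
  by congr (_ == 0); ring.
have DAB : A1 * B2 - A2 * B1 != 0.
  have -> : A1 * B2 - A2 * B1 = D t1 t2 * D t1 t3 * D t3 t2.
    by rewrite /A1 /A2 /B1 /B2 /D /det2; ring.
  by rewrite !mulf_neq0 // /D det2_vec_eq0 // eq_sym.
(* If all four coefficients vanish, these identities and the nonzero determinant give [A1 = A2 = 0],
   which makes the determinant 0. *)
have E1 : A1 ^+ n * (A1 * B2 - A2 * B1) =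
  A1 * (A1 ^+ n * B2 - B1 ^+ n * A2) - A2 * (A1 ^+ n * B1 - B1 ^+ n * A1) by ring.
have E2 : A2 ^+ n * (A1 * B2 - A2 * B1) =
  A1 * (A2 ^+ n * B2 - B2 ^+ n * A2) - A2 * (A2 ^+ n * B1 - B2 ^+ n * A1) by ring.
apply: contraNneq DAB => -[f1 f2 f3 f4].
move: E1 E2; rewrite f1 f2 f3 f4 !mulr0 subr0.
case: (eqVneq (A1 * B2 - A2 * B1) 0) => // D0 /eqP.
rewrite mulf_eq0 (negbTE D0) orbF expf_eq0 n_gt0 /= => /eqP A10 /eqP.
rewrite mulf_eq0 (negbTE D0) orbF expf_eq0 n_gt0 /= => /eqP A20.
by move: D0; rewrite A10 A20 !mul0r subrr eqxx.
Qed.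

End LucasForm.
End ProjectiveLine.

(** * Dehomogenization, and forms determined by their zeros *)

Lemma big_P1 (R : Type) (idx : R) (op : Monoid.com_law idx) (F : finFieldType)
    (S : {set P1 F}) (G : P1 F -> R) :
  \big[op/idx]_(t in S) G t =
  op (if None \in S then G None else idx)
     (\big[op/idx]_(x in Some @^-1: S) G (Some x)).
Proof.
rewrite big_mkcond (bigD1 None) //=; congr (op _ _).
rewrite -big_mkcondr (reindex_omap Some id) /=; last by case.
by apply: eq_bigl => x; rewrite inE eqxx andbT.
Qed.

(** The coefficients of degree [size s] agree, so the difference has degree less than [size s] and
    yet vanishes on all of [s]. *)
Lemma prod_factor (R : idomainType) (s : seq R) (g : {poly R}) :
  uniq s -> all (root g) s -> (size g <= (size s).+1)%N ->
  g = g`_(size s) *: \prod_(x <- s) ('X - x%:P).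
Proof.
move=> us rg sg; apply/eqP; rewrite -subr_eq0; apply/eqP.
set P := \prod_(x <- s) _.
have Pm : P \is monic by exact: monic_prod_XsubC.
have sP : size P = (size s).+1 by rewrite size_prod_XsubC.
apply: (roots_geq_poly_eq0 _ us); last first.
  apply/leq_sizeP => j; rewrite leq_eqVlt => /orP[/eqP<-|sj].
    have := monicP Pm; rewrite lead_coefE sP /= => Pc.
    by rewrite coefB coefZ Pc mulr1 subrr.
  by rewrite coefB coefZ nth_default ?(leq_trans sg) // [P`_j]nth_default ?sP // mulr0 subrr.
apply/allP => x xs; rewrite rootE !hornerE (eqP (allP rg x xs)).
have /eqP -> : P.[x] == 0 by rewrite -/(root P x) root_prod_XsubC.
by rewrite mulr0 subrr.
Qed.

Section Dehomogenization.
Variable F : finFieldType.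

(** The substitution Y = 1. The factor at oo becomes 1, so a zero at oo shows only as a drop in
    degree. *)
Definition dehom : {mpoly F[2]} -> {poly F} :=
  mmap polyC (fun i : 'I_2 => if i == ord0 then 'X else 1).

Lemma dehomX : dehom (vX F) = 'X.
Proof. by rewrite /dehom mmapX mmap1U. Qed.

Lemma dehomY : dehom (vY F) = 1.
Proof. by rewrite /dehom mmapX mmap1U. Qed.

(** Within a fixed total degree the exponent of X determines the monomial, so no two terms merge. *)
Lemma coef_dehom (k : nat) (f : {mpoly F[2]}) (m : 'X_{1..2}) :
  f \is k.-homog -> mdeg m = k -> (dehom f)`_(m ord0) = f@_m.
Proof.
move=> /dhomogP fk mk; rewrite /dehom /mmap coef_sum.
have mmapm (u : 'X_{1..2}) :
    mmap1 (fun i : 'I_2 => if i == ord0 then 'X else 1 : {poly F}) u = 'X^(u ord0).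
  by rewrite /mmap1 !big_ord_recl big_ord0 /= expr1n !mulr1.
have uE (u : 'X_{1..2}) : u \in msupp f -> (m ord0 == u ord0) = (u == m).
  move=> uf; apply/eqP/eqP => [E|-> //].
  have : mdeg u = mdeg m by rewrite mk; exact: fk.
  rewrite !mdegE !big_ord_recl !big_ord0 E !addn0 => /eqP.
  rewrite eqn_add2l => /eqP E2.
  apply/mnmP => -[[|[|//]] lti].
    by rewrite [Ordinal lti](_ : _ = ord0) ?E //; apply: val_inj.
  by rewrite [Ordinal lti](_ : _ = lift ord0 ord0) ?E2 //; apply: val_inj.
have [mf|mf] := boolP (m \in msupp f); last first.
  rewrite memN_msupp_eq0 // big_seq big1 // => u uf.
  rewrite mmapm coefCM coefXn uE //; case: eqP => [E|_]; last by rewrite mulr0.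
  by rewrite -E uf in mf.
rewrite (bigD1_seq m) ?msupp_uniq //= mmapm coefCM coefXn eqxx mulr1.
rewrite big_seq_cond big1 ?addr0 // => u /andP[uf um].
by rewrite mmapm coefCM coefXn uE // (negbTE um) mulr0.
Qed.

Lemma dehom_inj (k : nat) (f g : {mpoly F[2]}) :
  f \is k.-homog -> g \is k.-homog -> dehom f = dehom g -> f = g.
Proof.
move=> fk gk E; apply/mpolyP => m; have [mk|mk] := eqVneq (mdeg m) k.
  by rewrite -(coef_dehom fk) // -(coef_dehom gk) // E.
by rewrite (dhomog_nemf_coeff fk) // (dhomog_nemf_coeff gk).
Qed.

Lemma dehom_set_form (S : {set P1 F}) :
  dehom (set_form S) = \prod_(x in Some @^-1: S) ('X - x%:P).
Proof.
rewrite /set_form /dehom rmorph_prod -/dehom big_P1.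
have -> : (if None \in S then dehom (point_form None) else 1) = 1.
  by case: ifP => // _; rewrite dehomY.
rewrite /= mul1r; apply: eq_bigr => x _ /=.
by rewrite rmorphB /= mmapZ -/dehom dehomX dehomY mulr1.
Qed.

Definition lucas_form (n : nat) (a b c d : F) : {mpoly F[2]} :=
  a *: vX F ^+ n.+1 + b *: (vX F ^+ n * vY F)
  + c *: (vX F * vY F ^+ n) + d *: vY F ^+ n.+1.

Lemma lucas_form_homog n a b c d : lucas_form n a b c d \is n.+1.-homog.
Proof.
have Xh i : vX F ^+ i \is i.-homog.
  by have := dhomogMn i (vX_homog F); rewrite mul1n.
have Yh i : vY F ^+ i \is i.-homog.
  by have := dhomogMn i (vY_homog F); rewrite mul1n.
have XY : vX F ^+ n * vY F \is n.+1.-homog.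
  by rewrite -[n.+1]addn1; apply: dhomogM => //; exact: vY_homog.
have YX : vX F * vY F ^+ n \is n.+1.-homog.
  by rewrite -[n.+1]add1n; apply: dhomogM => //; exact: vX_homog.
by rewrite !rpredD // rpredZ //; exact: Xh || exact: Yh.
Qed.

Lemma dehom_lucas_form n a b c d : dehom (lucas_form n a b c d) =
  a *: 'X^(n.+1) + b *: 'X^n + c *: 'X + d%:P.
Proof.
rewrite /dehom !rmorphD /= !mmapZ !rmorphM !rmorphXn /= -/dehom dehomX dehomY.
by rewrite !expr1n !mulr1 !mul_polyC.
Qed.

Definition point_val (t : P1 F) : 'I_2 -> F :=
  fun i => if i == ord0 then (vec t).1 else (vec t).2.

Lemma meval_lucas_form n a b c d t :
  (lucas_form n a b c d).@[point_val t] = bil a b c d (frob n (vec t)) (vec t).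
Proof.
have X : (vX F).@[point_val t] = (vec t).1 by rewrite mevalXU.
have Y : (vY F).@[point_val t] = (vec t).2 by rewrite mevalXU.
rewrite !mevalD !mevalZ !mevalM !rmorphXn /= X Y /bil /frob /= !exprS; ring.
Qed.

Lemma meval_set_form (S : {set P1 F}) t :
  t \in S -> (set_form S).@[point_val t] = 0.
Proof.
move=> tS; rewrite /set_form (bigD1 t) //= mevalM.
suff -> : (point_form t).@[point_val t] = 0 by rewrite mul0r.
case: t {tS} => [x|] /=; last by rewrite mevalXU.
by rewrite mevalB mevalZ !mevalXU /= mulr1 subrr.
Qed.

Lemma set_form_neq0 (S : {set P1 F}) : set_form S != 0.
Proof.
apply/prodf_neq0 => -[x|] _ /=; apply/eqP => /(congr1 dehom).
  rewrite /dehom rmorphB /= mmapZ mmap0 -/dehom dehomX dehomY mulr1.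
  by move/eqP; rewrite polyXsubC_eq0.
by rewrite dehomY [dehom 0]mmap0 => /eqP; rewrite oner_eq0.
Qed.

(** A nonzero form of degree [n.+1] with the [n.+1] zeros [S] is a scalar multiple of [set_form S];
    dividing by the scalar gives the new coefficients. *)
Lemma set_form_lucas n (a b c d : F) (S : {set P1 F}) :
  #|S| = n.+1 -> (1 < n)%N -> (a, b, c, d) != 0 ->
  (forall t, t \in S -> vanishes n a b c d t) ->
  exists a' b' c' d', set_form S = lucas_form n a' b' c' d'.
Proof.
move=> cS n1 abcd SV; have n_gt0 := ltnW n1; set R := Some @^-1: S; set f := lucas_form n a b c d.
have rR : all (root (dehom f)) (enum R).
  apply/allP => x; rewrite mem_enum inE => /SV.
  rewrite /vanishes /bil /frob /= rootE /f dehom_lucas_form !hornerE expr1n => /eqP <-.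
  by apply/eqP; rewrite !exprS; ring.
have cR : #|S| = ((None \in S) + size (enum R))%N.
  rewrite -cardE -!sum1_card big_P1 /=; by case: ifP.
have sf : (size (dehom f) <= (size (enum R)).+1)%N.
  rewrite /f dehom_lucas_form.
  (* The value at oo is [a]. If oo lies in [S], the degree bound drops by one, just as the number of
     affine zeros does. *)
  have a0 : None \in S -> a = 0.
    by move/SV; rewrite /vanishes /bil /= !(mulr1, mulr0, addr0, expr1n, expr0n) gtn_eqF // mul0r addr0 mul1r => /eqP.
  have le1 : (size (b *: 'X^n + c *: 'X + d%:P : {poly F})%R <= n.+1)%N.
    rewrite (leq_trans (size_polyD _ _)) // geq_max (leq_trans (size_polyC_leq1 _)) // andbT.
    rewrite (leq_trans (size_polyD _ _)) // geq_max !(leq_trans (size_scale_leq _ _)) ?size_polyXn ?size_polyX //.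
  move: cR; rewrite cS; case: (boolP (None \in S)) => [/a0 ->|_].
    by rewrite add1n => -[<-]; rewrite scale0r add0r.
  rewrite add0n => <-; rewrite -!addrA (leq_trans (size_polyD _ _)) // geq_max addrA (leq_trans le1) // andbT.
  by rewrite (leq_trans (size_scale_leq _ _)) ?size_polyXn.
have := prod_factor (enum_uniq R) rR sf; set l := _`_(size _).
rewrite big_enum /= -dehom_set_form => E.
have fE : f = l *: set_form S.
  apply: (@dehom_inj n.+1); first exact: lucas_form_homog.
    by rewrite rpredZ // -cS set_form_homog.
  by rewrite [RHS]mmapZ mul_polyC.
have l0 : l != 0.
  apply: contra_neq abcd => l0.
  have f0 : dehom f = 0 by rewrite fE l0 scale0r /dehom mmap0.
  have cf i : (dehom f)`_i = 0 by rewrite f0 coef0.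
  move: (cf n.+1) (cf n) (cf 1%N) (cf 0%N); rewrite /f dehom_lucas_form.
  (* Since [n > 1], the exponents 0, 1, [n], [n.+1] are distinct, so each coefficient of [f] can be
     read off alone. *)
  have n1F : (n.+1 == n) = false by lia.
  have nF : (n == n.+1) = false by lia.
  rewrite !(coefD, coefZ, coefXn, coefX, coefC) !eqxx n1F nF.
  rewrite !eqSS (gtn_eqF n_gt0) [_ == 1%N]gtn_eqF // !(ltn_eqF n_gt0) !(ltn_eqF n1) /=.
  rewrite !(mulr0, mulr1, addr0, add0r).
  by move=> -> -> -> ->.
exists (l^-1 * a), (l^-1 * b), (l^-1 * c), (l^-1 * d).
rewrite -[LHS]scale1r -(mulVf l0) -scalerA -fE /f /lucas_form.
by rewrite !scalerDr !scalerA.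
Qed.

End Dehomogenization.

(** * Blocks of the Lucas subspace *)

Section Blocks.
Variables (F : finFieldType) (p m : nat).
Hypotheses (p_prime : prime p) (m_gt0 : (0 < m)%N).
Let n := (p ^ m)%N.

Let n_gt1 : (1 < n)%N.
Proof. by rewrite -{1}(expn0 p) ltn_exp2l ?prime_gt1. Qed.

Lemma WLuc_lucas (w : forms F (n + 1)) :
  w \in WLuc F p (n + 1) <-> exists a b c d, val w = lucas_form n a b c d.
Proof.
pose k := (n + 1)%N.
pose s := [seq monomial F j | j : 'I_k.+1 <- enum 'I_k.+1 & lep p j k].
have subZ x (u : forms F k) : val (x *: u) = x *: val u by [].
split=> [|[a [b [c [d wE]]]]].
  rewrite /WLuc => /(coord_span (X := in_tuple s)) ->.
  apply: (big_ind (fun w : forms F k =>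
            exists a b c d, val w = lucas_form n a b c d)).
  - by exists 0, 0, 0, 0; rewrite /lucas_form !scale0r !addr0.
  - move=> u v [a [b [c [d uE]]]] [a' [b' [c' [d' vE]]]].
    exists (a + a'), (b + b'), (c + c'), (d + d').
    rewrite raddfD /= uE vE /lucas_form !scalerDl.
    by rewrite addrACA; congr (_ + _); rewrite addrACA; congr (_ + _); rewrite addrACA.
  - move=> i _; set x := coord _ _ _; set u := _`_i.
    have : u \in s by exact: mem_nth.
    case/mapP=> j; rewrite mem_filter => /andP[jl _] ->.
    rewrite lep_qS // in jl; last by rewrite -ltnS.
    (* The indices 0, 1, [n], [n + 1] give X^(n+1), X^n Y, X Y^n, Y^(n+1), in the order of the
       coefficients of [lucas_form]. *)
    rewrite subZ /=; move: jl; rewrite !inE => /or4P[] /eqP ->;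
      [exists x, 0, 0, 0 | exists 0, x, 0, 0 | exists 0, 0, x, 0 | exists 0, 0, 0, x];
      rewrite /lucas_form !scale0r ?addr0 ?add0r /k addn1.
    + by rewrite subn0 mulr1.
    + by rewrite subn1.
    + by rewrite subSnn.
    + by rewrite subnn mul1r.
have sW j (jk : (j < k.+1)%N) : j \in [:: 0; 1; n; k]%N ->
    monomial F (Ordinal jk) \in WLuc F p k.
  move=> jl; apply: memv_span; apply: map_f; rewrite mem_filter mem_enum andbT.
  by rewrite lep_qS.
have k0 : (0 < k.+1)%N by [].
have k1 : (1 < k.+1)%N by rewrite /k; lia.
have kn : (n < k.+1)%N by rewrite /k; lia.
have kk : (k < k.+1)%N by [].
have -> : w = a *: monomial F (Ordinal k0) + b *: monomial F (Ordinal k1)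
            + c *: monomial F (Ordinal kn) + d *: monomial F (Ordinal kk).
  apply: val_inj; rewrite wE !raddfD /= /lucas_form /k subnn subn0 !addn1 subn1 subSnn.
  by rewrite mul1r mulr1.
by rewrite !rpredD // rpredZ // sW // !inE eqxx ?orbT.
Qed.

(** Membership of [set_form S] itself may be replaced by the existence of any nonzero form vanishing
    on [S], thanks to [set_form_lucas]. *)
Lemma blocks_lucas (S : {set P1 F}) :
  S \in blocks (WLuc F p (n + 1)) <->
  #|S| = (n + 1)%N /\ exists2 f : F * F * F * F, f != 0
    & forall t, t \in S -> vanishes n f.1.1.1 f.1.1.2 f.1.2 f.2 t.
Proof.
split.
  case/blocksP=> cS [w /WLuc_lucas[a [b [c [d ->]]]] E]; split=> //.
  exists (a, b, c, d) => [|t tS]; last first.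
    by rewrite /vanishes -meval_lucas_form E meval_set_form.
  apply: contra_neq (set_form_neq0 S); rewrite -E => -[-> -> -> ->].
  by rewrite /lucas_form !scale0r !addr0.
case=> cS [[[[a b] c] d] abcd SV]; apply/blocksP; split=> //.
have [|a' [b' [c' [d' E]]]] := set_form_lucas _ n_gt1 abcd SV.
  by rewrite cS addn1.
have Sk : set_form S \is (n + 1).-homog by rewrite -cS; exact: set_form_homog.
by exists (DHomog Sk) => //; apply/WLuc_lucas; exists a', b', c', d'.
Qed.

Hypothesis n_char : forall x y : F, (x + y) ^+ n = x ^+ n + y ^+ n.

Lemma block_subline (t1 t2 t3 : P1 F) (S : {set P1 F}) :
  t1 != t2 -> t1 != t3 -> t2 != t3 -> [set t1; t2; t3] \subset S ->
  S \in blocks (WLuc F p (n + 1)) -> S \subset subline t1 t2 t3 n.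
Proof.
move=> t12 t13 t23 /subsetP TS /blocks_lucas[_ [[[[a b] c] d] f0 SV]].
apply/subsetP => t /SV tV.
apply: (vanishes_subline (ltnW n_gt1) n_char t12 t13 t23 f0) => //.
all: by apply: SV; apply: TS; rewrite !inE eqxx ?orbT.
Qed.

(** A block has [n + 1 >= 3] points, and any three of them confine it to a subline, which here has
    at most [n] points. *)
Lemma blocks_eq0 : (#|fixed F n| < n)%N -> blocks (WLuc F p (n + 1)) = set0.
Proof.
move=> fn; apply/eqP; rewrite -subset0; apply/subsetP => S SB.
have [cS _] := (blocks_lucas S).1 SB.
have : (2 < #|S|)%N by rewrite cS; lia.
case/card_gt2P=> t1 [t2 [t3 [[S1 S2 S3] [t12 t23 t31]]]].
have TS : [set t1; t2; t3] \subset S.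
  by apply/subsetP => t; rewrite !inE -orbA => /or3P[] /eqP->.
rewrite eq_sym in t31.
have := subset_leq_card (block_subline t12 t31 t23 TS SB).
by rewrite card_subline // cS; lia.
Qed.

(** Here sublines have exactly [n + 1] points, so a block through three points equals their subline,
    and [subline_vanishes] makes that subline a block. *)
Lemma blocks_steiner : #|fixed F n| = n ->
  is_steiner (blocks (WLuc F p (n + 1))) 3 (n + 1) (#|F| + 1).
Proof.
move=> fn; split=> [|S /blocks_lucas[] //|T cT].
  by rewrite card_option addn1.
have : (2 < #|T|)%N by rewrite cT.
case/card_gt2P=> t1 [t2 [t3 [[T1 T2 T3] [t12 t23 t13]]]].
rewrite eq_sym in t13.
have TE : T = [set t1; t2; t3].
  apply/esym/eqP; rewrite eqEcard cT; apply/andP; split.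
    by apply/subsetP => t; rewrite !inE -orbA => /or3P[] /eqP->.
  by rewrite -setUA !cardsU1 cards1 !inE negb_or t12 t13 t23.
have cL : #|subline t1 t2 t3 n| = (n + 1)%N by rewrite card_subline // fn addn1.
apply/eqP/cards1P; exists (subline t1 t2 t3 n).
apply/setP => S; rewrite in_set in_set1 TE.
apply/andP/eqP => [[SB TS]|->].
  apply/eqP; rewrite eqEcard block_subline //= cL.
  by case/blocks_lucas: SB => ->.
split; last by apply: sub_subline => //; exact: ltnW.
apply/blocks_lucas; split=> //.
have [f [f0 fV]] := subline_vanishes (ltnW n_gt1) n_char t12 t13 t23.
by exists f.
Qed.
End Blocks.

(** * Counting the blocks, and the theorem *)

(** Double counting of pairs of a block and a [t]-subset of it. *)
Lemma steiner_card (P : finType) (B : {set {set P}}) (t k v : nat) :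
  is_steiner B t k v -> (#|B| * 'C(k, t) = 'C(v, t))%N.
Proof.
case=> cP kB B1; rewrite -cP -cardsT -cards_draws.
transitivity (\sum_(S in B) \sum_(T : {set P} | (T \subset S) && (#|T| == t)) 1)%N.
  rewrite -sum_nat_const; apply: eq_bigr => S SB.
  by rewrite sum1dep_card cards_draws (kB S).
rewrite (exchange_big_dep (fun T : {set P} => #|T| == t)) /=; last first.
  by move=> S T _ /andP[].
rewrite -sum1_card; apply: eq_big => [T|T cT]; first by rewrite inE subsetT.
rewrite sum1dep_card -(B1 T (eqP cT)); apply: eq_card => S.
by rewrite !inE cT andbT.
Qed.

Lemma bin3 (n : nat) : (0 < n)%N ->
  'C(n + 1, 3)%:R = n%:R * (n%:R ^+ 2 - 1) / 6%:R :> rat.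
Proof.
case: n => // n _; apply: (mulIf (_ : 6%:R != 0 :> rat)) => //.
rewrite divfK // -natrM (bin_ffact _ 3 : (_ * 6 = _)%N) !ffactnS ffactn0 addn1 /=.
by rewrite muln1 !natrM -!natr1; ring.
Qed.

Theorem proposition11 (p e m q q0 : nat) (F : finFieldType)
    (p_prime : prime p) (m_gt0 : (1 <= m)%N) (m_le_e : (m <= e)%N)
    (q_def : q = (p ^ e)%N) (q0_def : q0 = (p ^ m)%N) (card_F : #|F| = q) :
  let B := blocks (WLuc F p (q0 + 1)) in
  ((m %| e)%N ->
     [/\ #|B|%:R = 'C(q + 1, 3)%:R / 'C(q0 + 1, 3)%:R :> rat,
         'C(q + 1, 3)%:R / 'C(q0 + 1, 3)%:R
           = (q%:R * (q%:R ^+ 2 - 1)) / (q0%:R * (q0%:R ^+ 2 - 1)) :> rat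
       & is_steiner B 3 (q0 + 1) (q + 1)])
  /\ (~~ (m %| e)%N -> #|B| = 0%N).
Proof.
have p1 := prime_gt1 p_prime.
have q01 : (1 < q0)%N by rewrite q0_def -{1}(expn0 p) ltn_exp2l.
have charF : p \in [pchar F] by apply: card_finPcharP p_prime; rewrite card_F q_def.
have q0_char (x y : F) : (x + y) ^+ (p ^ m) = x ^+ (p ^ m) + y ^+ (p ^ m).
  by apply: exprDn_pchar; rewrite (eq_pnat _ (pcharf_eq charF)) pnatX pnat_id.
move=> B; split=> [/dvdnP[d eE]|me]; last first.
  apply/eqP; rewrite cards_eq0 /B q0_def; apply/eqP; apply: blocks_eq0 => //.
  by apply: (card_fixed_nroot (e := e)) => //; rewrite card_F.
have St : is_steiner B 3 (q0 + 1) (q + 1).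
  rewrite -card_F /B q0_def; apply: blocks_steiner => //.
  apply: (@card_fixed_root _ _ d); first by rewrite -q0_def.
  (* With [e = d * m], the order of [F] is [q0 ^ d]. *)
  by rewrite card_F q_def eE mulnC expnM.
have C0 : 'C(q0 + 1, 3)%:R != 0 :> rat.
  by rewrite Num.Theory.pnatr_eq0 -lt0n bin_gt0; lia.
split=> //.
  by rewrite -(steiner_card St) natrM mulfK.
have qgt0 : (0 < q)%N by rewrite q_def expn_gt0 ltnW.
(* The two denominators 6 cancel in the quotient. *)
by rewrite !bin3 ?(ltnW q01) // invfM invrK mulrACA [_^-1 * _]mulVf ?mulr1.
Qed.
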